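(* Let $\mathcal{G}$ be an infinite family of (finite, simple) graphs such that \[ \lambda_n(G)+\lambda_n(\overline{G})=n+o(n) \] for every $G\in\mathcal{G}$ of order $n$. Then $\mathcal{G}$ is quasi-random.
   Context: For a graph $H$ on $n$ vertices, $L(H)=D(H)-A(H)$ is its Laplacian, where $A(H)$ is the adjacency matrix and $D(H)$ the diagonal matrix of vertex degrees; its eigenvalues are $0=\lambda_1(H)\le\dots\le\lambda_n(H)$. The adjacency eigenvalues are $\mu_1(H)\ge\dots\ge\mu_n(H)$, $e(H)$ is the number of edges and $\overline{H}$ is the complement. An infinite family $\mathcal{G}$ of graphs is called quasi-random if for every $G\in\mathcal{G}$ of order $n$, $\mu_1(G)=2e(G)/n+o(n)$, $\mu_2(G)=o(n)$, and $\mu_n(G)=o(n)$. Throughout, $o(n)$ means bounded in absolute value by a function $g(n)$ with $g(n)/n\to0$, uniformly over all members of the family of order $n$. *)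

(* Defs.v *)
(* MathComp / MathComp-Analysis development. *)
From HB Require Import structures.
From mathcomp Require Import all_boot all_order all_algebra.
From mathcomp Require Import complex polyrcf.
From mathcomp Require Import all_classical all_reals all_analysis.

Set Implicit Arguments.
Unset Strict Implicit.
Unset Printing Implicit Defensive.

Import Order.TTheory GRing.Theory Num.Theory.
Import numFieldNormedType.Exports.

Local Open Scope classical_set_scope.
Local Open Scope ring_scope.

(* Finite simple graphs: the vertices are 0, ..., sorder - 1 and the edges are
   2-element sets of vertices.  As there are finitely many such graphs of each
   order, a set of them is infinite exactly when it contains infinitely many
   isomorphism types. *)
Record sgraph := SGraph {
  sorder : nat;
  edges : {set {set 'I_sorder}};
  edges_card2 : [forall e in edges, #|e| == 2%N]
}.

(* No loop is ever adjacent: [set i; i] has one element. *)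
Definition adj (H : sgraph) : rel 'I_(sorder H) :=
  fun i j => [set i; j]%SET \in edges H.

Definition degree (H : sgraph) (i : 'I_(sorder H)) : nat := #|[pred j | adj i j]|.

Lemma sgraph_compl_card2 (H : sgraph) :
  [forall e in [set e : {set 'I_(sorder H)} | (#|e| == 2%N) && (e \notin edges H)]%SET,
     #|e| == 2%N].
Proof. by apply/forall_inP => e; rewrite inE => /andP[]. Qed.

Definition sgraph_compl (H : sgraph) : sgraph := SGraph (sgraph_compl_card2 H).

Section Spectrum.
Variable R : realType.

Definition adjacency_mx (H : sgraph) : 'M[R]_(sorder H) :=
  \matrix_(i, j) (adj i j)%:R.

Definition degree_mx (H : sgraph) : 'M[R]_(sorder H) :=
  diag_mx (\row_i (degree i)%:R).

Definition laplacian_mx (H : sgraph) : 'M[R]_(sorder H) :=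
  degree_mx H - adjacency_mx H.

(* The real eigenvalues in nondecreasing order ([rootsR] is increasing), each
   repeated according to its algebraic multiplicity.  For symmetric A these are
   all n eigenvalues: see [eigenvalues_symE] and [size_eigenvalues_sym]. *)
Definition eigenvalues (n : nat) (A : 'M[R]_n) : seq R :=
  flatten [seq nseq (mup x (char_poly A)) x | x <- rootsR (char_poly A)].

(* [lambda H k] and [mu H k] are indexed from k = 1, and are 0 by convention
   when k > sorder H. *)
Definition lambda (H : sgraph) (k : nat) : R :=
  (eigenvalues (laplacian_mx H))`_k.-1.

Definition mu (H : sgraph) (k : nat) : R :=
  (rev (eigenvalues (adjacency_mx H)))`_k.-1.

(* f(G) = o(n), n being the order of G, uniformly over the members of F. *)
Definition o_order (F : set sgraph) (f : sgraph -> R) : Prop :=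
  exists g : nat -> R,
    ((fun n => g n / n%:R) @ \oo --> (0 : R)) /\
    (forall G, F G -> `|f G| <= g (sorder G)).

Definition quasi_random (F : set sgraph) : Prop :=
  [/\ infinite_set F,
      o_order F (fun G => mu G 1 - 2 * #|edges G|%:R / (sorder G)%:R),
      o_order F (fun G => mu G 2)
    & o_order F (fun G => mu G (sorder G))].

Lemma eigenvalues_sorted (n : nat) (A : 'M[R]_n) : sorted <=%R (eigenvalues A).
Proof.
rewrite /eigenvalues; set p := char_poly A.
have : sorted <%R (rootsR p) by exact: sorted_roots.
elim: (rootsR p) => //= x s IHs; rewrite lt_path_sortedE => /andP[ltxs /IHs].
set t := flatten _ => st.
have : all (>= x) t.
  apply/allP => y /flattenP[_ /mapP[z zs ->]] /nseqP[-> _].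
  exact/ltW/(allP ltxs).
elim: (mup x p) => //= m IHm xt; rewrite (path_sortedE le_trans) IHm // andbT.
rewrite all_cat xt andbT; apply/allP => y /nseqP[-> _]; exact: lexx.
Qed.

(* The spectral theorem, stated on characteristic polynomials. *)
Lemma eigenvalues_symE (n : nat) (A : 'M[R]_n) : A^T = A ->
  char_poly A = \prod_(x <- eigenvalues A) ('X - x%:P).
Proof.
move=> symA.
have [s Es] : exists s : seq R, char_poly A = \prod_(x <- s) ('X - x%:P).
  pose B : 'M[R[i]]_n := map_mx (real_complex R) A.
  have hB : B \is hermsymmx.
    apply/is_hermitianmxP; rewrite expr0 scale1r.
    apply/matrixP => i j; rewrite !mxE -{1}symA mxE.
    exact/esym/conjc_real.
  have /orthomx_spectralP EB := hermitian_normalmx hB.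
  have rB := hermitian_spectral_diag_real hB.
  have uP := spectral_unit B.
  pose d i := complex.Re (spectral_diag B 0 i).
  have dE i : real_complex R (d i) = spectral_diag B 0 i.
    by apply: RRe_real; exact: (mxOverP rB).
  exists [seq d i | i <- enum 'I_n].
  apply: (map_poly_inj (real_complex R)).
  rewrite map_char_poly -/B.
  have -> : char_poly B = char_poly (diag_mx (spectral_diag B)).
    move: (spectralmx B) (spectral_diag B) EB uP => P D -> uP.
    have PV : map_mx (@polyC R[i]) (invmx P) *m map_mx (@polyC R[i]) P = 1%:M.
      by rewrite -map_mxM mulVmx // map_mx1.
    rewrite /char_poly /char_poly_mx !map_mxM.
    set V := map_mx _ (invmx P) in PV *; set Q := map_mx _ P in PV *.
    have {1}-> : 'X%:M = V *m 'X%:M *m Q.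
      by rewrite scalar_mxC -mulmxA PV mulmx1.
    by rewrite -mulmxBl -mulmxBr !det_mulmx mulrAC -det_mulmx PV det1 mul1r.
  rewrite char_poly_trig ?diag_mx_is_trig // big_map big_enum rmorph_prod /=.
  by apply: eq_bigr => i _; rewrite !mxE eqxx mulr1n map_polyXsubC -dE.
have p0 : char_poly A != 0 by rewrite monic_neq0 ?char_poly_monic.
rewrite Es; apply: perm_big; apply/allP => x _; apply/eqP => /=.
rewrite -mu_prod_XsubC -Es /eigenvalues.
have : uniq (rootsR (char_poly A)) by exact: uniq_roots.
have : x \notin rootsR (char_poly A) -> mup x (char_poly A) = 0%N.
  rewrite -(roots_on_rootsR p0) in_itv /=; exact: mupNroot.
elim: (rootsR _) => [|y r IHr] /= xr => [_|/andP[yr ur]]; first exact: xr.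
rewrite count_cat count_nseq /=; have [xy|nxy] := eqVneq y x.
  rewrite mul1n -xy -[LHS]addn0; congr (_ + _)%N; apply/esym/count_memPn.
  apply: contra yr => /flattenP[_ /mapP[z zr ->]] /nseqP[-> _]; exact: zr.
rewrite mul0n add0n; apply: IHr => // xNr; apply: xr.
by rewrite inE negb_or eq_sym nxy.
Qed.

Lemma size_eigenvalues_sym (n : nat) (A : 'M[R]_n) :
  A^T = A -> size (eigenvalues A) = n.
Proof.
move=> /eigenvalues_symE /(congr1 (fun p : {poly R} => size p)).
by rewrite size_char_poly size_prod_XsubC => -[].
Qed.

End Spectrum.

(* Main.v *)
(* The Laplacians of G and of its complement add up to n I on the orthogonal
   complement of the all-ones vector 1.  With c, c' their largest eigenvalues
   and eps = c + c' - n, the quadratic form of L(G) on unit vectors of 1^perp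
   thus lies in [n - c', c], an interval of length eps.  Testing it on
   e_i - 1/n shows that all degrees agree up to |eps|.  Hence A = D - L has a
   form in [-|eps| - 1, |eps|] on unit vectors of 1^perp, while 1 is an
   eigenvector of A up to the deviations of the degrees from their average.
   Rayleigh quotients then bound mu_1, mu_2 and mu_n up to 2 |eps| + 1.  *)
Require Import Defs.
From mathcomp Require Import all_boot all_order all_algebra.
From mathcomp Require Import all_classical all_reals all_analysis.
From mathcomp Require Import zify ring lra.

Set Implicit Arguments.
Unset Strict Implicit.
Unset Printing Implicit Defensive.

Import Order.TTheory GRing.Theory Num.Theory.
Import numFieldNormedType.Exports.

Local Open Scope classical_set_scope.
Local Open Scope ring_scope.

(** * Inner products and quadratic forms on row vectors *)

Section Forms.
Variables (R : realType) (n : nat).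
Implicit Types (A B : 'M[R]_n) (x y z : 'rV[R]_n).

Definition dot x y : R := (x *m y^T) 0 0.
Definition quad A x : R := dot (x *m A) x.

Lemma dotE x y : dot x y = \sum_i x 0 i * y 0 i.
Proof. by rewrite /dot mxE; apply: eq_bigr => i _; rewrite mxE. Qed.

Lemma dotC x y : dot x y = dot y x.
Proof. by rewrite !dotE; apply: eq_bigr => i _; rewrite mulrC. Qed.

Lemma dotDl x y z : dot (x + y) z = dot x z + dot y z.
Proof. by rewrite /dot mulmxDl mxE. Qed.

Lemma dotZl a x z : dot (a *: x) z = a * dot x z.
Proof. by rewrite /dot -scalemxAl mxE. Qed.

Lemma dotDr x y z : dot z (x + y) = dot z x + dot z y.
Proof. by rewrite !(dotC z) dotDl. Qed.

Lemma dotZr a x z : dot z (a *: x) = a * dot z x.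
Proof. by rewrite !(dotC z) dotZl. Qed.

Lemma dotxx_ge0 x : 0 <= dot x x.
Proof. by rewrite dotE sumr_ge0 // => i _; rewrite -expr2 sqr_ge0. Qed.

Lemma dotxx_gt0 x : x != 0 -> 0 < dot x x.
Proof.
move=> x0; rewrite lt_def dotxx_ge0 andbT; apply: contra x0 => /eqP.
rewrite dotE => /psumr_eq0P x0; apply/eqP/rowP => i; rewrite mxE.
have := x0 _ i isT; rewrite -expr2 => /(_ _)/eqP; rewrite sqrf_eq0 => h.
by apply/eqP/h => j _; rewrite -expr2 sqr_ge0.
Qed.

Lemma dot_sym A x y : A^T = A -> dot (x *m A) y = dot x (y *m A).
Proof. by move=> sA; rewrite /dot trmx_mul sA mulmxA. Qed.

Lemma quadD A B x : quad (A + B) x = quad A x + quad B x.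
Proof. by rewrite /quad mulmxDr dotDl. Qed.

Lemma quad_add A a x y : A^T = A ->
  quad A (a *: x + y) = a ^+ 2 * quad A x + 2 * a * dot (x *m A) y + quad A y.
Proof.
move=> sA; rewrite /quad mulmxDl -scalemxAl !(dotDl, dotDr, dotZl, dotZr).
by rewrite (dotC (y *m A) x) -(dot_sym _ _ sA); ring.
Qed.

Lemma quad_diag (d : 'rV[R]_n) x :
  quad (diag_mx d) x = \sum_i d 0 i * x 0 i ^+ 2.
Proof.
rewrite /quad dotE; apply: eq_bigr => i _.
by rewrite mul_mx_diag mxE mulrAC expr2 mulrC mulrA [RHS]mulrC mulrC.
Qed.

End Forms.

(** * Orthogonal diagonalization of real symmetric matrices *)

Section Spectral.
Variable R : realType.

(** The reflection in the hyperplane orthogonal to [v - e] exchanges the unit vectors [e] and [v].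
    It serves to extend a unit eigenvector to an orthonormal basis. *)
Lemma householder n (v : 'rV[R]_n.+1) : dot v v = 1 ->
  exists2 H : 'M[R]_n.+1, H *m H^T = 1%:M & row 0 H = v.
Proof.
move=> v1; pose e : 'rV[R]_n.+1 := delta_mx 0 0.
have ee : dot e e = 1.
  by rewrite /dot trmx_delta mul_delta_mx mxE !eqxx.
pose u := v - e.
(* If [v = e] there is no hyperplane to reflect in, and the identity serves. *)
have [u0|u0] := eqVneq u 0.
  exists 1%:M; first by rewrite trmx1 mulmx1.
  by rewrite rowE mulmx1; apply/esym/eqP; rewrite -subr_eq0 -/u u0.
have uu : dot u u != 0 by rewrite gt_eqF // dotxx_gt0.
have uuT : u *m u^T = (dot u u)%:M by rewrite [LHS]mx11_scalar.
(* Both sides equal 2 - 2 [dot e v], as [e] and [v] are unit vectors. This gives the reflection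
   coefficient -1 below, so that [e] goes to [e + u = v]. *)
have uE : dot u u = - 2 * dot e u.
  rewrite /u -scaleN1r !(dotDl, dotDr, dotZl, dotZr) v1 ee (dotC e v); ring.
exists (1%:M - (2 / dot u u) *: (u^T *m u)).
  have -> : (1%:M - (2 / dot u u) *: (u^T *m u))^T = 1%:M - (2 / dot u u) *: (u^T *m u).
    by rewrite raddfB /= trmx1 linearZ /= trmx_mul trmxK.
  set c := 2 / _; set M := u^T *m u.
  have MM : M *m M = dot u u *: M.
    by rewrite /M mulmxA -(mulmxA _ u) uuT mul_mx_scalar -scalemxAl.
  rewrite mulmxBl mul1mx mulmxBr mulmx1 -scalemxAl -scalemxAr MM !scalerA -mulrA.
  rewrite divfK // (mulrC c) mulr_natl mulr2n scalerDl.
  by rewrite opprB addrK subrK.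
rewrite rowE mulmxBr mulmx1 -scalemxAr mulmxA -/e.
have -> : e *m u^T = (dot e u)%:M by rewrite [LHS]mx11_scalar.
rewrite mul_scalar_mx scalerA.
have -> : 2 / dot u u * dot e u = -1.
  have := uu; rewrite uE mulf_eq0 negb_or => /andP[_ eu]; field.
  by rewrite eu.
by rewrite scaleN1r opprK addrC /u subrK.
Qed.

(** Deflation by induction on the size: in an orthonormal basis that starts with a unit eigenvector,
    a symmetric matrix splits into a 1 x 1 block and a smaller symmetric block. *)
Lemma real_spectral n (A : 'M[R]_n) : A^T = A ->
  exists (P : 'M[R]_n) (d : 'rV[R]_n),
    P *m P^T = 1%:M /\ A = P^T *m diag_mx d *m P.
Proof.
elim: n A => [|n IHn] A symA.
  by exists 0, 0; rewrite !(flatmx0 (_ *m _)) (flatmx0 1%:M) (flatmx0 A).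
(* The characteristic polynomial splits over the reals, and its list of roots has n + 1 > 0
   entries. *)
have [a /eigenvalueP[w wA w0]] : exists a, eigenvalue A a.
  have := eigenvalues_symE symA; have := size_eigenvalues_sym symA.
  case: (eigenvalues A) => // a s _ E; exists a.
  by rewrite eigenvalue_root_char E root_prod_XsubC mem_head.
pose v := (Num.sqrt (dot w w))^-1 *: w.
have w1 := dotxx_gt0 w0.
have v1 : dot v v = 1.
  rewrite dotZl dotZr mulrA -invfM -expr2 sqr_sqrtr ?ltW //.
  by rewrite mulVf // gt_eqF.
have vA : v *m A = a *: v by rewrite -scalemxAl wA !scalerA mulrC.
have [H HH rH] := householder v1.
have HH' : H^T *m H = 1%:M by apply: mulmx1C.
pose B : 'M[R]_(1 + n) := H *m A *m H^T.
have symB : B^T = B by rewrite /B !trmx_mul trmxK symA mulmxA.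
have rB : row 0 B = a *: delta_mx 0 0.
  rewrite /B !row_mul rH vA -scalemxAl -rH -row_mul HH.
  by rewrite rowE mulmx1.
have BD : B = H *m A *m H^T by [].
clearbody B.
(* The first row of [B] is known from [rB]; symmetry then clears the first column. *)
have BE : B = block_mx a%:M 0 0 (drsubmx B).
  rewrite -{1}(submxK B); congr block_mx.
  - apply/matrixP => i j; rewrite !ord1 !mxE.
    have := congr1 (fun r : 'rV_n.+1 => r 0 0) rB; rewrite !mxE eqxx mulr1 => <-.
    by congr (B _ _); apply: val_inj.
  - apply/matrixP => i j; rewrite !ord1 !mxE.
    have := congr1 (fun r : 'rV_n.+1 => r 0 (rshift 1 j)) rB.
    by rewrite !mxE /= mulr0 => <-; congr (B _ _); apply: val_inj.
  - apply/matrixP => i j; rewrite !ord1 !mxE -symB mxE.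
    have := congr1 (fun r : 'rV_n.+1 => r 0 (rshift 1 i)) rB.
    by rewrite !mxE /= mulr0 => <-; congr (B _ _); apply: val_inj.
have [|P [d [PP dE]]] := IHn (drsubmx B); first by rewrite trmx_drsub symB.
pose Q : 'M[R]_(1 + n) := block_mx 1%:M 0 0 P.
have QT : Q^T = block_mx 1%:M 0 0 P^T.
  by rewrite /Q (tr_block_mx 1%:M) !trmx0 trmx1.
have QQ : Q *m Q^T = 1%:M.
  by rewrite QT mulmx_block !mulmx0 !mul0mx mulmx1 addr0 !add0r PP -scalar_mx_block.
have QBQ : Q^T *m diag_mx (row_mx a%:M d) *m Q = B.
  rewrite QT diag_mx_row BE dE !mulmx_block.
  rewrite !mulmx0 !mul0mx !addr0 !add0r mulmx1 mul1mx.
  by rewrite !mul0mx; congr block_mx; apply/matrixP => i j; rewrite !ord1 !mxE.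
exists (Q *m H), (row_mx a%:M d : 'rV_(1 + n)); split.
  by rewrite trmx_mul mulmxA -(mulmxA Q) HH mulmx1.
have -> : A = H^T *m B *m H.
  by rewrite BD !mulmxA HH' mul1mx -mulmxA HH' mulmx1.
by rewrite -QBQ trmx_mul !mulmxA.
Qed.

Lemma char_poly_spectral n (P : 'M[R]_n) (d : 'rV[R]_n) : P *m P^T = 1%:M ->
  char_poly (P^T *m diag_mx d *m P) = \prod_i ('X - (d 0 i)%:P).
Proof.
move=> /mulmx1C PP.
pose f := map_mx (@polyC R).
have ff : f _ _ P^T *m f _ _ P = 1%:M by rewrite -map_mxM PP map_mx1.
have -> : char_poly (P^T *m diag_mx d *m P) = char_poly (diag_mx d).
  rewrite /char_poly /char_poly_mx !map_mxM.
  have {1}-> : 'X%:M = f _ _ P^T *m 'X%:M *m f _ _ P.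
    by rewrite scalar_mxC -mulmxA ff mulmx1.
  by rewrite -mulmxBl -mulmxBr !det_mulmx mulrAC -det_mulmx ff det1 mul1r.
rewrite char_poly_trig ?diag_mx_is_trig //.
by apply: eq_bigr => i _; rewrite !mxE eqxx.
Qed.

End Spectral.

(** * Rayleigh quotients and the ordered eigenvalues *)

Section Rayleigh.
Variables (R : realType) (n : nat) (A : 'M[R]_n).
Hypothesis symA : A^T = A.

(** Both lists are the roots of one characteristic polynomial, and factorization into linear factors
    is unique. *)
Lemma eigenvalues_spectral (P : 'M[R]_n) (d : 'rV[R]_n) :
  P *m P^T = 1%:M -> A = P^T *m diag_mx d *m P ->
  perm_eq (eigenvalues A) [seq d 0 i | i <- enum 'I_n].
Proof.
move=> PP AE; apply: prod_XsubC_eq.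
by rewrite -eigenvalues_symE // AE char_poly_spectral // big_map big_enum.
Qed.

Lemma quad_spectral (P : 'M[R]_n) (d : 'rV[R]_n) x :
  A = P^T *m diag_mx d *m P ->
  quad A x = \sum_i d 0 i * (x *m P^T) 0 i ^+ 2.
Proof.
move=> AE; rewrite -quad_diag AE /quad /dot !mulmxA.
by rewrite trmx_mul trmxK mulmxA.
Qed.

Lemma dot_orthogonal (P : 'M[R]_n) x : P *m P^T = 1%:M ->
  dot x x = \sum_i (x *m P^T) 0 i ^+ 2.
Proof.
move=> /mulmx1C PP; transitivity (dot (x *m P^T) (x *m P^T)).
  by rewrite /dot trmx_mul trmxK mulmxA -(mulmxA x) PP mulmx1.
by rewrite dotE; apply: eq_bigr => i _; rewrite expr2.
Qed.

(** In an orthonormal eigenbasis the form is the sum of the eigenvalues weighted by the squared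
    coordinates of [x], and these weights add up to [dot x x]. *)
Lemma quad_eigenvalue_bounds x :
  (eigenvalues A)`_0 * dot x x <= quad A x <= (eigenvalues A)`_n.-1 * dot x x.
Proof.
have [P [d [PP AE]]] := real_spectral symA.
have bounds i : (eigenvalues A)`_0 <= d 0 i <= (eigenvalues A)`_n.-1.
  have : d 0 i \in eigenvalues A.
    by rewrite (perm_mem (eigenvalues_spectral PP AE)) map_f ?mem_enum.
  move=> /(nthP 0)[k]; rewrite size_eigenvalues_sym // => kn <-.
  have sA : sorted <=%O (eigenvalues A) by exact: eigenvalues_sorted.
  apply/andP; split; apply: (le_sorted_leq_nth 0 sA);
    by rewrite ?inE ?size_eigenvalues_sym //; lia.
rewrite (quad_spectral x AE) (dot_orthogonal x PP) !mulr_sumr.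
apply/andP; split; apply: ler_sum => i _; apply: ler_wpM2r;
  by rewrite ?sqr_ge0 //; have /andP[] := bounds i.
Qed.

Lemma eigenvalues_mem_bounds l h a :
  (forall x, l * dot x x <= quad A x <= h * dot x x) ->
  a \in eigenvalues A -> l <= a <= h.
Proof.
move=> lh aA; have /eigenvalueP[v vA v0] : eigenvalue A a.
  by rewrite eigenvalue_root_char eigenvalues_symE // root_prod_XsubC.
have := lh v; rewrite /quad vA dotZl => /andP[].
by rewrite !ler_pM2r ?dotxx_gt0 // => -> ->.
Qed.

(** One half of the Courant-Fischer principle: two eigenvalues above [c] would give a plane of
    eigenvector combinations on which the form exceeds [c * dot x x], and this plane contains a
    nonzero vector orthogonal to [u]. *)
Lemma second_eigenvalue_le (u : 'rV[R]_n) c : (1 < n)%N ->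
  (forall x, dot x u = 0 -> quad A x <= c * dot x x) ->
  (eigenvalues A)`_n.-2 <= c.
Proof.
move=> n1 le_c.
have [P [d [PP AE]]] := real_spectral symA.
have rowA i : row i P *m A = d 0 i *: row i P.
  rewrite AE !mulmxA -row_mul PP -!row_mul mul1mx row_mul.
  by rewrite row_diag_mx -scalemxAl -rowE.
have dotP i j : dot (row i P) (row j P) = (i == j)%:R.
  have := congr1 (fun M : 'M[R]_n => M i j) PP; rewrite /dot !mxE => <-.
  by apply: eq_bigr => k _; rewrite !mxE.
have : (#|[pred i | (c < d 0 i)%R]| <= 1)%N.
  rewrite leqNgt; apply/negP => /card_gt1P[i [j [ci cj ij]]].
  pose p k := dot (row k P) u.
  (* One linear condition on two coefficients has a nonzero solution: (1, 0) if [p i] vanishes,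
     otherwise ([p j], - [p i]). *)
  have [a [b [ab0 abp]]] : exists a b, 0 < a ^+ 2 + b ^+ 2 /\ a * p i + b * p j = 0.
    have [pi0|pi0] := eqVneq (p i) 0.
      by exists 1, 0; rewrite pi0; split; lra.
    exists (p j), (- p i); split; last ring.
    by rewrite sqrrN ltr_wpDl ?sqr_ge0 // lt_def sqrf_eq0 pi0 sqr_ge0.
  pose x := a *: row i P + b *: row j P.
  have xu : dot x u = 0 by rewrite dotDl !dotZl.
  have := le_c x xu; rewrite /quad mulmxDl -!scalemxAl !rowA.
  rewrite !(dotDl, dotDr, dotZl, dotZr) !dotP !eqxx (negPf ij) eq_sym (negPf ij).
  move: ci cj ab0; rewrite !inE; clear; move: (d 0 i) (d 0 j) => di dj.
  rewrite -(subr_gt0 c di) -(subr_gt0 c dj) => ci cj ab0.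
  rewrite !(mulr0, mulr1, addr0, add0r) => q.
  have [a0|a0] := eqVneq a 0.
    by move: q ab0; rewrite a0 => q ab0; have := mulr_gt0 cj ab0; lra.
  have a2 : 0 < a ^+ 2 by rewrite lt_def sqrf_eq0 a0 sqr_ge0.
  have := mulr_gt0 ci a2; have := mulr_ge0 (ltW cj) (sqr_ge0 b); move: q; lra.
(* At least n - 1 entries of the sorted list are at most [c], hence so is the entry at the
   zero-based index n - 2. *)
move=> card_gt; apply: (@nth_count_le _ _ c 0 _ n.-2).
  exact: eigenvalues_sorted.
rewrite (permP (eigenvalues_spectral PP AE)) count_map.
have := cardC [pred i | c < d 0 i]; rewrite card_ord => nE.
have -> : count (preim (d 0) (<= c)) (enum 'I_n) = #|[predC [pred i | c < d 0 i]]|.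
  rewrite -size_filter enumT cardE /enum_mem; congr size.
  by apply: eq_filter => i /=; rewrite !inE leNgt.
move: n1 nE card_gt; move: #|_| #|_| => k m; lia.
Qed.

End Rayleigh.

(** * Degrees, adjacency and Laplacian of a graph and its complement *)

Lemma degreeE (R : realType) (H : sgraph) (i : 'I_(sorder H)) :
  (degree i)%:R = \sum_j (adj i j)%:R :> R.
Proof.
rewrite /degree -sum1_card natr_sum big_mkcond.
by apply: eq_bigr => j _ /=; rewrite inE; case: adj.
Qed.

Section Graph.
Variables (R : realType) (H : sgraph).
Local Notation n := (sorder H).
Local Notation A := (adjacency_mx R H).
Local Notation L := (laplacian_mx R H).
Local Notation L' := (laplacian_mx R (sgraph_compl H) : 'M[R]_n).
Local Notation ones := (const_mx 1 : 'rV[R]_n).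
Local Notation deg i := ((@degree H i)%:R : R).

Lemma adjC (i j : 'I_n) : adj i j = adj j i.
Proof. by rewrite /adj finset.setUC. Qed.

Lemma edge_card (e : {set 'I_n}) : e \in edges H -> #|e| = 2%N.
Proof. by move=> eH; apply/eqP; apply: (forall_inP (edges_card2 H)). Qed.

Lemma adj_irr (i : 'I_n) : adj i i = false.
Proof. by apply/negP => /edge_card; rewrite finset.setUid cards1. Qed.

Lemma adj_compl (i j : 'I_n) :
  @adj (sgraph_compl H) i j = (i != j) && ~~ adj i j.
Proof.
rewrite /adj inE cards2; by case: (i != j).
Qed.

(** Handshake lemma, by double counting incident pairs of a vertex and an edge. The edges at [i] are
    counted through the map sending a neighbour [j] to the set of [i] and [j], which is injective as
    there are no loops. *)
Lemma sum_degree : (\sum_i @degree H i = 2 * #|edges H|)%N.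
Proof.
have degE (i : 'I_n) : degree i = #|[set e in edges H | i \in e]%SET|.
  rewrite /degree -(card_in_imset (f := fun j => [set i; j]%SET)); last first.
    move=> j k; rewrite !inE => ij ik /setP jk.
    have /esym := jk j; rewrite !inE eqxx orbT => /orP[/eqP ji|/eqP //].
    by move: ij; rewrite ji adj_irr.
  apply: eq_card => e; rewrite !inE; apply/imsetP/andP.
    by move=> [j]; rewrite inE => ij ->; rewrite !inE eqxx.
  move=> [eH ie]; have /eqP/cards2P[j [k [jk eE]]] := edge_card eH.
  move: ie; rewrite eE !inE => /orP[]/eqP ->.
    by exists k; rewrite // inE /adj -eE.
  by exists j; rewrite 1?finset.setUC // inE /adj finset.setUC -eE.
rewrite (eq_bigr _ (fun i _ => degE i)).
under eq_bigr => i _ do rewrite -sum1_card big_mkcond /=.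
rewrite exchange_big /=.
transitivity (\sum_(e in edges H) 2)%N; last by rewrite sum_nat_const mulnC.
rewrite [RHS]big_mkcond; apply: eq_bigr => e _.
have [eH|eH] := boolP (e \in edges H); last first.
  by rewrite big1 // => i _; rewrite inE (negPf eH).
rewrite -(edge_card eH) -sum1_card [RHS]big_mkcond.
by apply: eq_bigr => i _; rewrite inE eH.
Qed.

Lemma tr_adjacency_mx : A^T = A.
Proof. by apply/matrixP => i j; rewrite !mxE adjC. Qed.

Lemma tr_laplacian_mx : L^T = L.
Proof. by rewrite /laplacian_mx raddfB /= tr_adjacency_mx tr_diag_mx. Qed.

Lemma ones_adjacency_mx : ones *m A = \row_i deg i.
Proof.
apply/rowP => i; rewrite !mxE degreeE; apply: eq_bigr => j _.
by rewrite !mxE mul1r adjC.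
Qed.

Lemma ones_laplacian_mx : ones *m L = 0.
Proof.
rewrite /laplacian_mx mulmxBr ones_adjacency_mx mul_mx_diag.
by apply/rowP => i; rewrite !mxE mul1r subrr.
Qed.

Lemma quad_adjacency_mx x :
  quad A x = \sum_i deg i * x 0 i ^+ 2 - quad L x.
Proof.
have -> : \sum_i deg i * x 0 i ^+ 2 = quad (degree_mx R H) x.
  by rewrite quad_diag; apply: eq_bigr => i _; rewrite mxE.
by apply/eqP; rewrite eq_sym subr_eq -quadD /laplacian_mx addrC subrK.
Qed.

(** The right-hand side is the Laplacian of the complete graph, whose edges the graph and its
    complement share out. *)
Lemma laplacian_mx_compl : L + L' = n%:R%:M - ones^T *m ones.
Proof.
apply/matrixP => i j; rewrite !mxE big_ord1 !mxE mulr1 adj_compl.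
have [->|ij] := eqVneq i j; last by rewrite !mulr0n /=; case: adj => /=; lra.
rewrite !mulr1n adj_irr degreeE (@degreeE _ (sgraph_compl H)) /= !subr0 -big_split /=.
(* On the diagonal the two degrees add up to n - 1: each vertex other than [j] is a neighbour in
   exactly one of the two graphs. *)
rewrite (eq_bigr (fun k => 1 - (k == j)%:R)); last first.
  move=> k _; rewrite adj_compl eq_sym; have [->|] := eqVneq k j.
    by rewrite adj_irr /=; lra.
  by case: adj => /=; lra.
by rewrite sumrB sumr_const card_ord (bigD1 j) //= eqxx big1 ?addr0 // => k /negPf->.
Qed.

Lemma quad_laplacian_compl x :
  quad L x + quad L' x = n%:R * dot x x - dot x ones ^+ 2.
Proof.
rewrite -quadD laplacian_mx_compl /quad mulmxBr -scaleN1r dotDl dotZl.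
rewrite mul_mx_scalar dotZl mulmxA.
have -> : x *m ones^T = (dot x ones)%:M by rewrite [LHS]mx11_scalar.
by rewrite mul_scalar_mx dotZl (dotC ones) mulN1r expr2.
Qed.

End Graph.

(** The final error bound 2 |eps| + 1 is still o(n), since the constant contributes only 1/n after
    division by n. *)
Lemma o_bound (R : realType) (g : nat -> R) :
  (fun n => g n / n%:R) @ \oo --> (0 : R) ->
  (fun n => (2 * `|g n| + 1) / n%:R) @ \oo --> (0 : R).
Proof.
move=> g0.
have inv0 : (fun n => n%:R^-1 : R) @ \oo --> (0 : R).
  by rewrite -cvg_shiftS; exact: cvg_harmonic.
have -> : (fun n => (2 * `|g n| + 1) / n%:R) =
    (fun n => 2 * `|g n / n%:R| + n%:R^-1).
  by apply/funext => n; rewrite mulrDl mul1r -mulrA normrM normfV normr_nat.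
have -> : (0 : R) = 2 * `|0 : R| + 0 by rewrite normr0 mulr0 addr0.
apply: cvgD inv0; apply: cvgMr; exact: cvg_norm.
Qed.

(** * Estimates for a single nonempty graph *)

Section Estimates.
Variables (R : realType) (H : sgraph).
Local Notation n := (sorder H).
Local Notation A := (adjacency_mx R H).
Local Notation L := (laplacian_mx R H).
Local Notation L' := (laplacian_mx R (sgraph_compl H) : 'M[R]_n).
Local Notation ones := (const_mx 1 : 'rV[R]_n).
Local Notation deg i := ((@degree H i)%:R : R).
Hypothesis n_gt0 : (0 < n)%N.
Let N : R := n%:R.
Let c1 := lambda R H n.
Let c2 := lambda R (sgraph_compl H) n.
Let E := `|c1 + c2 - N|.
Let avg : R := 2 * #|edges H|%:R / N.

Let N_gt0 : 0 < N. Proof. by rewrite ltr0n. Qed.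
Let N_neq0 : N != 0. Proof. by rewrite gt_eqF. Qed.
Let E_ge : c1 + c2 - N <= E. Proof. exact: ler_norm. Qed.
Let E_ge0 : 0 <= E. Proof. exact: normr_ge0. Qed.

Lemma dot_ones : dot ones ones = N.
Proof.
rewrite dotE (eq_bigr (fun=> 1)) ?sumr_const ?card_ord // => i _.
by rewrite mxE mulr1.
Qed.

Let invN : 0 < N^-1 <= 1.
Proof. by rewrite invr_gt0 N_gt0 invf_le1 // ler1n. Qed.

Let quad_le_c1 x : quad L x <= c1 * dot x x.
Proof. by have /andP[] := quad_eigenvalue_bounds (tr_laplacian_mx R H) x. Qed.

Let quad_compl_le_c2 x : quad L' x <= c2 * dot x x.
Proof.
by have /andP[] := quad_eigenvalue_bounds (tr_laplacian_mx R (sgraph_compl H)) x.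
Qed.

Let c1_ge0 : 0 <= c1.
Proof.
have := quad_le_c1 ones; rewrite /quad ones_laplacian_mx dot_ones.
by rewrite -(scale0r ones) dotZl mul0r pmulr_lge0.
Qed.

Let c2_ge0 : 0 <= c2.
Proof.
have := quad_compl_le_c2 ones; rewrite /quad.
rewrite (ones_laplacian_mx R (sgraph_compl H)) dot_ones.
by rewrite -(scale0r ones) dotZl mul0r pmulr_lge0.
Qed.

(** The two Laplacian forms add up to [N * dot x x] here, so an upper bound on the complement is a
    lower bound on [L]. *)
Let quad_ge_perp x : dot x ones = 0 -> (N - c2) * dot x x <= quad L x.
Proof.
move=> x1; have := quad_laplacian_compl x; rewrite x1 expr0n subr0.
by have := quad_compl_le_c2 x; rewrite -/N; lra.
Qed.

(** The projection [y] of the basis vector [e] onto the orthogonal complement of [ones] has squared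
    norm 1 - 1/N. As [ones] is in the kernel of [L], the form at [y] is the diagonal entry of [L],
    which is the degree. *)
Let degree_bounds i : (N - c2) * (1 - N^-1) <= deg i <= c1 * (1 - N^-1).
Proof.
pose e : 'rV[R]_n := delta_mx 0 i.
pose y := (- N^-1) *: ones + e.
have e1 : dot ones e = 1.
  rewrite dotC /dot -rowE !mxE; reflexivity.
have y1 : dot y ones = 0.
  by rewrite dotDl dotZl dot_ones dotC e1 mulNr mulVf // addNr.
have ee : dot e e = 1.
  by rewrite /dot trmx_delta mul_delta_mx mxE !eqxx.
have yy : dot y y = 1 - N^-1.
  by rewrite {2}/y dotDr dotZr y1 mulr0 add0r dotDl dotZl e1 ee mulr1 addrC.
have qy : quad L y = deg i.
  rewrite /y quad_add ?tr_laplacian_mx // /quad ones_laplacian_mx.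
  rewrite -(scale0r ones) !dotZl !(mul0r, mulr0) !add0r.
  by rewrite /dot trmx_delta -rowE -colE !mxE eqxx adj_irr subr0.
have := quad_le_c1 y; have := quad_ge_perp y1.
by rewrite yy qy => -> ->.
Qed.

Let sum_deg : \sum_i deg i = N * avg.
Proof. by rewrite /avg mulrC divfK -?natr_sum ?sum_degree ?natrM. Qed.

Let avg_bounds : (N - c2) * (1 - N^-1) <= avg <= c1 * (1 - N^-1).
Proof.
have cst (c : R) : \sum_(i < n) c = N * c by rewrite sumr_const card_ord mulr_natl.
rewrite -(ler_pM2l N_gt0) -[X in _ && X](ler_pM2l N_gt0) -sum_deg -!cst.
by rewrite !ler_sum // => i _; have /andP[] := degree_bounds i.
Qed.

(** A degree and the average degree lie in a common interval of length (c1 + c2 - N)(1 - 1/N). *)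
Let sub_avg i : `|deg i - avg| <= E.
Proof.
have /andP[l1 h1] := degree_bounds i; have /andP[l2 h2] := avg_bounds.
have /andP[N0 N1] := invN.
have : (c1 + c2 - N) * (1 - N^-1) <= E.
  have [le0|ge0] := leP (c1 + c2 - N) 0.
    by apply: le_trans E_ge0; rewrite mulr_le0_ge0 // subr_ge0.
  apply: le_trans E_ge; rewrite ger_pMr //; lra.
by rewrite ler_norml; lra.
Qed.

Let sum_sqr (x : 'rV[R]_n) : dot x x = \sum_i x 0 i ^+ 2.
Proof. by rewrite dotE; apply: eq_bigr => i _; rewrite expr2. Qed.

(** With A = D - L, the form of D is controlled by the degree bounds and that of L by [quad_le_c1]
    and [quad_ge_perp]. The extra 1 in the lower bound comes from the factor 1 - 1/N in the degree
    bounds, through N * 1/N = 1. *)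
Lemma quad_adjacency_perp x : dot x ones = 0 ->
  - (E + 1) * dot x x <= quad A x <= E * dot x x.
Proof.
move=> x1; rewrite quad_adjacency_mx.
have : (N - c2) * (1 - N^-1) * dot x x <= \sum_i deg i * x 0 i ^+ 2.
  rewrite sum_sqr mulr_sumr; apply: ler_sum => i _.
  by apply: ler_wpM2r; [exact: sqr_ge0 | have /andP[] := degree_bounds i].
have : \sum_i deg i * x 0 i ^+ 2 <= c1 * (1 - N^-1) * dot x x.
  rewrite sum_sqr mulr_sumr; apply: ler_sum => i _.
  by apply: ler_wpM2r; [exact: sqr_ge0 | have /andP[] := degree_bounds i].
have xx := dotxx_ge0 x; have /andP[N0 N1] := invN.
have c1N : 0 <= c1 * N^-1 by rewrite mulr_ge0 // ltW.
have c2N : 0 <= c2 * N^-1 by rewrite mulr_ge0 // ltW.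
have le1 : (c1 * (1 - N^-1) - (N - c2)) * dot x x <= E * dot x x.
  by rewrite ler_wpM2r //; move: E_ge; lra.
have NV : N * N^-1 = 1 by rewrite divff.
have le2 : - (E + 1) * dot x x <= ((N - c2) * (1 - N^-1) - c1) * dot x x.
  by rewrite ler_wpM2r //; move: E_ge; lra.
have := quad_le_c1 x; have := quad_ge_perp x1; move: le1 le2.
by rewrite !mulrBl; lra.
Qed.

(** Split [x] into its projection on [ones] and a remainder [y] orthogonal to it. The first part
    contributes the average degree; the cross term and the form at [y] cost one [E] each, with a
    further 1 from below. *)
Lemma quad_adjacency_bounds x :
  - (2 * E + 1) * dot x x <= quad A x <= (avg + 2 * E) * dot x x.
Proof.
pose a := dot x ones / N; pose y := x - a *: ones.
have xE : x = a *: ones + y by rewrite /y addrC subrK.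
have y1 : dot y ones = 0.
  by rewrite /y -scaleNr dotDl dotZl dot_ones mulNr divfK // subrr.
clearbody y a.
have xx : dot x x = a ^+ 2 * N + dot y y.
  rewrite xE !(dotDl, dotDr, dotZl, dotZr) dot_ones (dotC ones) y1; ring.
have qx : quad A x = a ^+ 2 * (N * avg) +
    \sum_i (2 * a * (deg i - avg) * y 0 i) + quad A y.
  rewrite {1}xE quad_add ?tr_adjacency_mx // /quad ones_adjacency_mx.
  congr (_ * _ + _ + _).
    by rewrite -sum_deg dotE; apply: eq_bigr => i _; rewrite !mxE mulr1.
  (* The entries of [y] sum to 0, so [avg] may be subtracted from every degree in the cross term. *)
  rewrite (eq_bigr (fun i => 2 * a * (deg i * y 0 i) - 2 * a * avg * y 0 i)).
    rewrite sumrB -!mulr_sumr [X in _ - _ * X](_ : _ = 0).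
      by rewrite mulr0 subr0 dotE; congr (_ * _); apply: eq_bigr => i _; rewrite mxE.
    by rewrite -[RHS]y1 dotE; apply: eq_bigr => i _; rewrite mxE mulr1.
  by move=> i _; ring.
(* AM-GM: [2 |a| |y_i| <= a^2 + y_i^2] *)
have cross : `|\sum_i (2 * a * (deg i - avg) * y 0 i)| <= E * dot x x.
  have -> : E * dot x x = \sum_(i < n) E * (a ^+ 2 + y 0 i ^+ 2).
    rewrite -mulr_sumr big_split /= -sum_sqr sumr_const card_ord -mulr_natr.
    by rewrite xx.
  apply: le_trans (ler_norm_sum _ _ _) _; apply: ler_sum => i _.
  rewrite -mulrA mulrCA normrM ler_pM ?normr_ge0 ?sub_avg // ler_norml.
  have := sqr_ge0 (a - y 0 i); have := sqr_ge0 (a + y 0 i).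
  by rewrite sqrrB sqrrD; lra.
have /andP[l h] := quad_adjacency_perp y1.
have a0 : 0 <= a ^+ 2 * N by rewrite mulr_ge0 ?sqr_ge0 // ltW.
have avg0 : 0 <= avg by rewrite /avg mulr_ge0 ?invr_ge0 ?mulr_ge0 ?ler0n // ltW.
have y0 := dotxx_ge0 y.
move: cross; rewrite ler_norml qx => /andP[].
move: (\sum_i _) => S.
have p1 := mulr_ge0 avg0 a0; have p2 := mulr_ge0 avg0 y0.
have p3 := mulr_ge0 E_ge0 a0; have p4 := mulr_ge0 E_ge0 y0.
move: l h; rewrite xx; lra.
Qed.

Let mu_first : mu R H 1 = (eigenvalues A)`_n.-1.
Proof.
by rewrite /mu /= nth_rev size_eigenvalues_sym ?tr_adjacency_mx ?subn1.
Qed.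

Let mu_last : mu R H n = (eigenvalues A)`_0.
Proof.
rewrite /mu nth_rev size_eigenvalues_sym ?tr_adjacency_mx ?prednK //.
by rewrite subnn.
Qed.

Let eigenvalue_bounds k : (k < n)%N ->
  - (2 * E + 1) <= (eigenvalues A)`_k <= avg + 2 * E.
Proof.
move=> kn; apply: (eigenvalues_mem_bounds (tr_adjacency_mx R H)).
  exact: quad_adjacency_bounds.
by rewrite mem_nth // size_eigenvalues_sym // tr_adjacency_mx.
Qed.

(** The Rayleigh quotient of [ones] is the average degree, so only the upper estimate carries an
    error. *)
Lemma mu_first_bound : `|mu R H 1 - avg| <= 2 * E + 1.
Proof.
have /andP[_ ub] : - (2 * E + 1) <= mu R H 1 <= avg + 2 * E.
  by rewrite mu_first eigenvalue_bounds // ltn_predL.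
have : avg <= mu R H 1.
  have /andP[_] := quad_eigenvalue_bounds (tr_adjacency_mx R H) ones.
  rewrite -mu_first dot_ones /quad ones_adjacency_mx dotE.
  under eq_bigr => i _ do rewrite !mxE mulr1.
  by rewrite sum_deg mulrC ler_pM2r.
by rewrite ler_norml; have := E_ge0; lra.
Qed.

Lemma mu_second_bound : `|mu R H 2| <= 2 * E + 1.
Proof.
have sA := tr_adjacency_mx R H.
rewrite /mu /=; have [n1|n1] := leqP n 1.
  (* With at most one vertex there is no second eigenvalue, and [mu] takes its default value 0. *)
  rewrite nth_default ?size_rev ?size_eigenvalues_sym // normr0.
  by have := E_ge0; lra.
rewrite nth_rev size_eigenvalues_sym // subn2.
have /andP[lb _] : - (2 * E + 1) <= (eigenvalues A)`_n.-2 <= avg + 2 * E.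
  by apply: eigenvalue_bounds; lia.
have : (eigenvalues A)`_n.-2 <= E.
  apply: (second_eigenvalue_le sA (u := ones) n1) => x x1.
  by have /andP[] := quad_adjacency_perp x1.
by rewrite ler_norml; have := E_ge0; lra.
Qed.

Lemma mu_last_bound : `|mu R H n| <= 2 * E + 1.
Proof.
have /andP[lb _] : - (2 * E + 1) <= mu R H n <= avg + 2 * E.
  by rewrite mu_last eigenvalue_bounds.
(* Test on a basis vector: the diagonal of the adjacency matrix is 0. *)
have : mu R H n <= 0.
  pose e : 'rV[R]_n := delta_mx 0 (Ordinal n_gt0).
  have /andP[+ _] := quad_eigenvalue_bounds (tr_adjacency_mx R H) e.
  rewrite -mu_last /quad /dot trmx_delta mul_delta_mx -rowE -colE !mxE adj_irr.
  by rewrite !eqxx mulr1.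
by rewrite ler_norml; have := E_ge0; lra.
Qed.

End Estimates.

(** * From single graphs to the family *)

Lemma mu_order0 (R : realType) (H : sgraph) k : sorder H = 0%N -> mu R H k = 0.
Proof.
move=> H0; rewrite /mu nth_default // size_rev size_eigenvalues_sym ?H0 //.
exact: tr_adjacency_mx.
Qed.

Theorem theorem2 (R : realType) (F : set sgraph)
  (F_infinite : infinite_set F)
  (F_lambda : o_order F (fun G : sgraph =>
     lambda R G (sorder G) + lambda R (sgraph_compl G) (sorder G) - (sorder G)%:R)) :
  quasi_random R F.
Proof.
have [g [g0 Fg]] := F_lambda.
have o_le (f : sgraph -> R) :
    (forall G, sorder G = 0%N -> f G = 0) ->
    (forall G, (0 < sorder G)%N ->
      `|f G| <= 2 * `|lambda R G (sorder G) + lambda R (sgraph_compl G) (sorder G)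
                      - (sorder G)%:R| + 1) ->
    o_order F f.
  (* The absolute value keeps the bound nonnegative at every order, in particular at order 0, where
     the estimates for nonempty graphs do not apply. *)
  move=> f0 fb; exists (fun n => 2 * `|g n| + 1); split; first exact: o_bound.
  move=> G FG; have [G0|G0] := posnP (sorder G).
    by rewrite f0 // normr0 addr_ge0 // mulr_ge0.
  apply: le_trans (fb G G0) _; rewrite lerD2r ler_pM2l //.
  exact: le_trans (Fg G FG) (ler_norm _).
split => //; apply: o_le => G G0.
(* For the graph without vertices, division by zero gives 0, so the average degree is 0 as well. *)
- have -> : (sorder G)%:R = 0 :> R by rewrite G0.
  by rewrite mu_order0 // invr0 mulr0 subr0.
- exact: mu_first_bound.
- exact: mu_order0.
- exact: mu_second_bound.
- exact: mu_order0.
- exact: mu_last_bound.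
Qed.
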